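(* Let $\Omega$ be a bounded finitely connected region in $\mathbb{C}$ and let $n$ be a positive integer. (a) If $\varphi\in H^{\infty}(\Omega,L(\mathbb{C}^{n}))$ and $u\in H^{\infty}(\Omega)$ are quasi-inner functions such that $\varphi(z)\psi(z)=u(z)I_{\mathbb{C}^n}$ (for $z\in\Omega$), where $\psi\in H^{\infty}(\Omega,L(\mathbb{C}^{n}))$, then $\psi$ is also quasi-inner. (b) Conversely, if $\varphi\in H^{\infty}(\Omega,L(\mathbb{C}^{n}))$ and $\psi\in H^{\infty}(\Omega,L(\mathbb{C}^{n}))$ are quasi-inner functions such that $\varphi(z)\psi(z)=u(z)I_{\mathbb{C}^n}$ (for $z\in\Omega$) or $\psi(z)\varphi(z)=u(z)I_{\mathbb{C}^n}$ (for $z\in\Omega$) for some $u\in H^{\infty}(\Omega)$ with $u\neq 0$, then $u$ is quasi-inner.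
   Context: $H^{\infty}(\Omega)$ is the Banach algebra of bounded holomorphic functions on $\Omega$ with the supremum norm. $L(\mathbb{C}^n)$ is the algebra of linear operators on $\mathbb{C}^n$, and $H^{\infty}(\Omega,L(\mathbb{C}^n))$ is the space of bounded analytic functions $\Omega\to L(\mathbb{C}^n)$ with the supremum norm. Fix $z_0\in\Omega$; ''almost every'' on $\partial\Omega$ is with respect to the harmonic measure $m$ for $z_0$. Bounded analytic functions have nontangential boundary limits at almost every point of $\partial\Omega$, and for $z\in\partial\Omega$ the values $\varphi(z)$, $u(z)$ denote these limits. A function $\varphi\in H^{\infty}(\Omega,L(\mathbb{C}^n))$ is quasi-inner if there is a constant $c>0$ such that $\|\varphi(z)k\|\ge c\|k\|$ for every $k\in\mathbb{C}^n$ and almost every $z\in\partial\Omega$. A function $u\in H^\infty(\Omega)$ is quasi-inner if there is a constant $c>0$ such that $|u(z)|\ge c$ for almost every $z\in\partial\Omega$. *)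

(* Defs.v *)
From HB Require Import structures.
From mathcomp Require Import all_boot all_order all_algebra complex.
From mathcomp Require Import all_classical all_reals all_analysis.

Set Implicit Arguments.
Unset Strict Implicit.
Unset Printing Implicit Defensive.

Import Order.TTheory GRing.Theory Num.Theory.
Import numFieldNormedType.Exports.

Local Open Scope classical_set_scope.
Local Open Scope ring_scope.
Local Open Scope complex_scope.

(* The topology and the normed structure of mathcomp-analysis are attached to
   abstract structures such as [numClosedFieldType], hence this packaging. *)
Definition Cx (R : realType) : numClosedFieldType := R[i].

(* Absolute value as a real number; [`|z|] itself has type [Cx R]. *)
Definition cabs (R : realType) (z : Cx R) : R := complex.Re `|z|.

Definition enorm (R : realType) (n : nat) (k : 'cV[Cx R]_n) : R :=
  Num.sqrt (\sum_(i < n) cabs (k i 0) ^+ 2).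

Definition borelC (R : realType) := g_sigma_algebraType (@open (Cx R)).

Definition bdry (R : realType) (W : set (Cx R)) : set (Cx R) :=
  closure W `\` interior W.

(* The complement in the Riemann sphere has finitely many components. *)
Definition finitely_connected (R : realType) (W : set (Cx R)) : Prop :=
  let K : set (one_point_compactification (Cx R)) := ~` (Some @` W) in
  finite_set (connected_component K @` K).

Definition bounded_fc_region (R : realType) (W : set (Cx R)) : Prop :=
  [/\ open W, connected W, W !=set0, bounded_set W & finitely_connected W].

Definition holomorphic_on (R : realType) (V : normedModType (Cx R))
    (W : set (Cx R)) (f : Cx R -> V) : Prop :=
  forall z, W z -> derivable (f : (Cx R)^o -> V) z 1.

Definition Hinfty (R : realType) (W : set (Cx R)) (u : Cx R -> Cx R) : Prop :=
  holomorphic_on W (u : Cx R -> (Cx R)^o) /\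
  exists M : R, forall z, W z -> cabs (u z) <= M.

(* Operators on C^n are n x n matrices acting on column vectors; the bound is
   on the operator norm induced by [enorm]. *)
Definition HinftyL (R : realType) (n : nat) (W : set (Cx R))
    (phi : Cx R -> 'M[Cx R]_n) : Prop :=
  holomorphic_on W phi /\
  exists M : R, forall z, W z ->
    forall k : 'cV[Cx R]_n, enorm (phi z *m k) <= M * enorm k.

(* z lies in the approach region of aperture [a] at [zeta] when
   |z - zeta| <= (1 + a) dist(z, bdry W). *)
Definition approach_region (R : realType) (W : set (Cx R)) (zeta : Cx R)
    (a : R) : set (Cx R) :=
  [set z | W z /\
    forall w, bdry W w -> cabs (z - zeta) <= (1 + a) * cabs (z - w)].

(* Some approach region is required to accumulate at [zeta]; otherwise every
   [l] would vacuously be a limit. With it, [l] is unique. *)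
Definition nontangential_limit (R : realType) (T : topologicalType)
    (W : set (Cx R)) (f : Cx R -> T) (zeta : Cx R) (l : T) : Prop :=
  (exists2 a : R, 0 < a & closure (approach_region W zeta a) zeta) /\
  forall a : R, 0 < a ->
    f @ within (approach_region W zeta a) (nbhs zeta) --> l.

Definition subharmonic (R : realType) (W : set (Cx R)) (v : Cx R -> R) : Prop :=
  {within W, continuous v} /\
  forall (a : Cx R) (r : R), 0 < r ->
    [set z : Cx R | cabs (z - a) <= r] `<=` W ->
    v a <= (2 * pi)^-1 *
      \int[lebesgue_measure]_(t in `[0, 2 * pi])
        v (a + (r * cos t +i* (r * sin t))).

(* The last clause is limsup_(z -> zeta) v z <= f zeta. *)
Definition perron_family (R : realType) (W : set (Cx R)) (f : Cx R -> R) :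
    set (Cx R -> R) :=
  [set v | subharmonic W v /\
    forall zeta, bdry W zeta -> forall e : R, 0 < e ->
      \forall z \near within W (nbhs zeta), v z <= f zeta + e].

(* Perron solution of the Dirichlet problem with boundary data f. *)
Definition perron (R : realType) (W : set (Cx R)) (f : Cx R -> R) (z : Cx R) :
    R :=
  sup [set v z | v in perron_family W f].

(* Stated as the defining property of m rather than as a construction: for
   bounded W and z0 in W it determines m uniquely. *)
Definition harmonic_measure (R : realType) (W : set (Cx R)) (z0 : Cx R)
    (m : probability (borelC R) R) : Prop :=
  m (bdry W : set (borelC R)) = 1%E /\
  forall f : Cx R -> R, {within bdry W, continuous f} ->
    \int[m]_(z in (bdry W : set (borelC R))) f z = perron W f z0.

(* The value at a boundary point is the nontangential limit there. *)
Definition quasi_inner (R : realType) (W : set (Cx R))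
    (m : probability (borelC R) R) (u : Cx R -> Cx R) : Prop :=
  Hinfty W u /\
  exists2 c : R, 0 < c &
    \forall z \ae m, bdry W z ->
      exists2 l : Cx R, nontangential_limit W u z l & c <= cabs l.

Definition quasi_innerL (R : realType) (n : nat) (W : set (Cx R))
    (m : probability (borelC R) R) (phi : Cx R -> 'M[Cx R]_n) : Prop :=
  HinftyL W phi /\
  exists2 c : R, 0 < c &
    \forall z \ae m, bdry W z ->
      exists2 L : 'M[Cx R]_n, nontangential_limit W phi z L &
        forall k : 'cV[Cx R]_n, c * enorm k <= enorm (L *m k).

(* Main.v *)
Require Import Defs.
From mathcomp Require Import all_boot all_order all_algebra complex.
From mathcomp Require Import all_classical all_reals all_analysis.

Import Order.TTheory GRing.Theory Num.Theory.
Import numFieldNormedType.Exports.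

Local Open Scope classical_set_scope.
Local Open Scope ring_scope.

(** At a boundary point where phi has an invertible nontangential limit L and
    u has a nontangential limit l, the equation phi psi = u I says that
    psi = phi^-1 (u I) on the part of any approach region close to that point,
    since invertible matrices form an open set; inversion being continuous,
    psi tends nontangentially to P = L^-1 (l I).  Thus the boundary values of
    psi come from those of phi and u alone, and the factorization passes to the
    boundary: L P = l I.  For the same reason, if phi and psi have limits L and
    P, then u, a diagonal entry of phi psi, has a limit l with L P = l I.

    The two assertions are then estimates on L P = l I.  For (a), a bound M for
    phi is also a bound for its boundary value L, so
    |l| ||k|| = ||L P k|| <= M ||P k||, and a lower bound d for |l| gives the
    lower bound d / M for P.  For (b), lower bounds c and d for L and P give
    |l| ||k|| = ||L P k|| >= c d ||k||, whence |l| >= c d.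

    The argument takes place at each boundary point where both given functions
    have their limits and bounds.  The limits are treated for matrices over a
    numeric field along an arbitrary filter ([cvg_mulmx_factor],
    [cvg_scalar_mulmx_diag], [cvg_scalar_mulmx_lim]) and then specialized to
    approach regions. *)

(** * Limits of matrices *)

Section matrix_limits.
Context {K : numFieldType} {T : Type} {F : set_system T} {FF : Filter F}.

Lemma cvg_sumr (I : Type) (r : seq I) (P : pred I) (f : I -> T -> K)
    (a : I -> K) :
  (forall i, f i x @[x --> F] --> a i) ->
  (\sum_(i <- r | P i) f i x) @[x --> F] --> \sum_(i <- r | P i) a i.
Proof.
move=> fa; apply: cvg_big => [|i _]; last exact: fa.
exact: add_continuous.
Qed.

Lemma cvg_prodr (I : Type) (r : seq I) (P : pred I) (f : I -> T -> K)
    (a : I -> K) :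
  (forall i, f i x @[x --> F] --> a i) ->
  (\prod_(i <- r | P i) f i x) @[x --> F] --> \prod_(i <- r | P i) a i.
Proof.
move=> fa; apply: cvg_big => [|i _]; last exact: fa.
exact: mul_continuous.
Qed.

Lemma cvg_mxP {m n : nat} (f : T -> 'M[K]_(m, n)) (A : 'M[K]_(m, n)) :
  f @ F --> A <-> forall i j, f x i j @[x --> F] --> A i j.
Proof.
split=> [fA i j|fA].
  exact: (continuous_cvg _ (@coord_continuous K m n i j A) fA).
move=> B [P AP PB].
apply: filterS (_ : F [set x | forall i j, P i j (f x i j)]).
  by move=> x; exact: PB.
by apply: filter_forall => i; apply: filter_forall => j; apply: fA; exact: AP.
Qed.

Lemma cvg_mulmx {m n p : nat} (f : T -> 'M[K]_(m, n)) (g : T -> 'M[K]_(n, p))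
    (A : 'M[K]_(m, n)) (B : 'M[K]_(n, p)) :
  f @ F --> A -> g @ F --> B -> f x *m g x @[x --> F] --> A *m B.
Proof.
move=> /cvg_mxP fA /cvg_mxP gB; apply/cvg_mxP => i k.
rewrite mxE; under eq_fun do rewrite mxE.
by apply: cvg_sumr => j; apply: cvgM; [exact: fA|exact: gB].
Qed.

Lemma cvg_scalar_mx {n : nat} (f : T -> K) (a : K) :
  f @ F --> a -> (f x)%:M @[x --> F] --> (a%:M : 'M[K]_n).
Proof.
move=> fa; apply/cvg_mxP => i j; rewrite mxE; under eq_fun do rewrite mxE.
by case: (i == j); [exact: fa|exact: cvg_cst].
Qed.

Lemma cvg_det {n : nat} (f : T -> 'M[K]_n) (A : 'M[K]_n) :
  f @ F --> A -> \det (f x) @[x --> F] --> \det A.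
Proof.
move=> /cvg_mxP fA; apply: cvg_sumr => s; apply: cvgM; first exact: cvg_cst.
by apply: cvg_prodr => i; exact: fA.
Qed.

Lemma cvg_adjugate {n : nat} (f : T -> 'M[K]_n) (A : 'M[K]_n) :
  f @ F --> A -> \adj (f x) @[x --> F] --> \adj A.
Proof.
move=> /cvg_mxP fA; apply/cvg_mxP => i j; rewrite mxE.
under eq_fun do rewrite mxE.
apply: cvgM; first exact: cvg_cst.
apply: cvg_det; apply/cvg_mxP => k l; rewrite !mxE.
by under eq_fun do rewrite !mxE; exact: fA.
Qed.

Lemma near_unitmx {n : nat} (f : T -> 'M[K]_n) (A : 'M[K]_n) :
  A \in unitmx -> f @ F --> A -> \forall x \near F, f x \in unitmx.
Proof.
rewrite unitmxE unitfE => detA /cvg_det /cvgr_neq0 /(_ detA).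
by apply: filterS => x; rewrite unitmxE unitfE.
Qed.

(** Cramer's formula expresses the inverse as a rational function of the
    entries.  [invmx] is given by that formula on invertible matrices and is
    the identity elsewhere, hence the recourse to [near_unitmx]. *)
Lemma cvg_invmx {n : nat} (f : T -> 'M[K]_n) (A : 'M[K]_n) :
  A \in unitmx -> f @ F --> A -> invmx (f x) @[x --> F] --> invmx A.
Proof.
move=> uA fA.
have detA : \det A != 0 by rewrite -unitfE -unitmxE.
have invE B : B \in unitmx -> (\det B)^-1 *: \adj B = invmx B.
  by rewrite /invmx => ->.
apply: cvg_trans (_ : (\det (f x))^-1 *: \adj (f x) @[x --> F] --> _).
  apply: near_eq_cvg; apply: filterS (near_unitmx f A uA fA) => x.
  exact: invE.
rewrite -invE//; apply/cvg_mxP => i j; rewrite mxE; under eq_fun do rewrite mxE.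
apply: cvgM; first by apply: cvgV => //; exact: cvg_det.
by move: i j; apply/cvg_mxP; exact: cvg_adjugate.
Qed.

(** Near the limit [f x] is invertible, so that [g x] can be solved for as
    [invmx (f x) *m (u x)%:M], a product of convergent functions. *)
Lemma cvg_mulmx_factor {n : nat} (f g : T -> 'M[K]_n) (u : T -> K)
    (A : 'M[K]_n) (a : K) :
  A \in unitmx -> f @ F --> A -> u @ F --> a ->
  (\forall x \near F, f x *m g x = (u x)%:M) ->
  g @ F --> invmx A *m a%:M.
Proof.
move=> uA fA ua fgu.
apply: cvg_trans (_ : invmx (f x) *m (u x)%:M @[x --> F] --> _).
  apply: near_eq_cvg; apply: filterS2 fgu (near_unitmx f A uA fA) => x <- ufx.
  by rewrite mulKmx.
by apply: cvg_mulmx; [exact: cvg_invmx|exact: cvg_scalar_mx].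
Qed.

(** [F] may be improper here: at a boundary point, only the approach regions of
    large aperture are known to accumulate. *)
Lemma cvg_scalar_mulmx_diag {n : nat} (f g : T -> 'M[K]_n) (u : T -> K)
    (A B : 'M[K]_n) (i : 'I_n) :
  f @ F --> A -> g @ F --> B ->
  (\forall x \near F, f x *m g x = (u x)%:M) ->
  u @ F --> (A *m B) i i.
Proof.
move=> fA gB fgu.
have /cvg_mxP /(_ i i) : (u x)%:M @[x --> F] --> A *m B.
  apply: cvg_trans (_ : f x *m g x @[x --> F] --> _); last exact: cvg_mulmx.
  exact: near_eq_cvg.
by under eq_fun do rewrite mxE eqxx mulr1n.
Qed.

End matrix_limits.

(** Scalar matrices are closed under limits, by uniqueness of the limit of each
    entry. *)
Lemma cvg_scalar_mulmx_lim {K : numFieldType} {T : Type} {F : set_system T}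
    {FF : ProperFilter F} {n : nat} (f g : T -> 'M[K]_n) (u : T -> K)
    (A B : 'M[K]_n) (i0 : 'I_n) :
  f @ F --> A -> g @ F --> B ->
  (\forall x \near F, f x *m g x = (u x)%:M) ->
  A *m B = ((A *m B) i0 i0)%:M.
Proof.
move=> fA gB fgu; apply/matrixP => i j.
have ua := cvg_scalar_mulmx_diag (FF := FF) f g u A B i0 fA gB fgu.
have fgAB := cvg_mulmx (FF := FF) f g A B fA gB.
have fgu' : f x *m g x @[x --> F] -->
    (((A *m B) i0 i0)%:M : 'M[K]_n).
  apply: cvg_trans (near_eq_cvg _) (cvg_scalar_mx (FF := FF) u _ ua).
  by apply: filterS fgu => x ->.
have /cvg_mxP /(_ i j) lij := fgAB.
have /cvg_mxP /(_ i j) lij' := fgu'.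
exact: (cvg_unique (@norm_hausdorff _ _) lij lij').
Qed.

(** * Absolute value and Euclidean norm *)

Section euclidean_norm.
Context {R : realType}.
Implicit Types z w : Cx R.

(** Transfers to the real-valued [cabs] the properties of the norm, which
    takes its values in the complex numbers. *)
Lemma normr_cabs z : `|z| = ((cabs z)%:C)%C.
Proof. by rewrite /cabs normc_def. Qed.

Lemma cabs_ge0 z : 0 <= cabs z.
Proof. by rewrite /cabs normc_def /= sqrtr_ge0. Qed.

Lemma cabsM z w : cabs (z * w) = cabs z * cabs w.
Proof.
by apply: (@complexI R); rewrite rmorphM /= -!normr_cabs normrM.
Qed.

Lemma cabs_eq0 z : (cabs z == 0) = (z == 0).
Proof. by rewrite -(normr_eq0 z) normr_cabs -(inj_eq (@complexI R)). Qed.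

Lemma cabs_dist z w : `|cabs z - cabs w| <= cabs (z - w).
Proof.
rewrite -lecR -normr_cabs.
have -> : (`|cabs z - cabs w|%:C)%C = `| `|z| - `|w| | :> Cx R.
  by rewrite !normr_cabs -rmorphB [RHS]normc_def /= expr0n addr0 sqrtr_sqr.
exact: ler_dist_dist.
Qed.

Lemma cvg_cabs {T : Type} {F : set_system T} {FF : Filter F} (f : T -> Cx R) z :
  f @ F --> z -> cabs (f x) @[x --> F] --> cabs z.
Proof.
move=> fz; apply/cvgrPdist_lt => e e0.
have e0C : 0 < (e%:C)%C :> Cx R by rewrite ltcR.
move/cvgrPdist_lt : fz => /(_ _ e0C); apply: filterS => x.
by rewrite normr_cabs ltcR; apply: le_lt_trans; exact: cabs_dist.
Qed.

Lemma enorm_ge0 {n : nat} (k : 'cV[Cx R]_n) : 0 <= enorm k.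
Proof. exact: sqrtr_ge0. Qed.

Lemma enorm_eq0 {n : nat} (k : 'cV[Cx R]_n) : enorm k = 0 -> k = 0.
Proof.
move/eqP; rewrite sqrtr_eq0 => s0; apply/matrixP => i j; rewrite ord1 mxE.
have sq_ge0 (l : 'I_n) : true -> 0 <= cabs (k l 0) ^+ 2 by rewrite sqr_ge0.
have /eqP : \sum_(l < n) cabs (k l 0) ^+ 2 = 0.
  by apply: le_anti; rewrite s0 sumr_ge0.
rewrite psumr_eq0// => /allP /(_ i (mem_index_enum i)) /=.
by rewrite sqrf_eq0 cabs_eq0 => /eqP.
Qed.

Lemma enorm0 {n : nat} : enorm (0 : 'cV[Cx R]_n) = 0.
Proof.
rewrite /enorm big1 ?sqrtr0// => i _; apply/eqP.
by rewrite sqrf_eq0 cabs_eq0 mxE.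
Qed.

Lemma enorm_scalar {n : nat} z (k : 'cV[Cx R]_n) :
  enorm (z%:M *m k) = cabs z * enorm k.
Proof.
rewrite mul_scalar_mx /enorm.
under eq_bigr do rewrite mxE cabsM exprMn.
by rewrite -mulr_sumr sqrtrM ?sqr_ge0// sqrtr_sqr ger0_norm ?cabs_ge0.
Qed.

Lemma cvg_enorm {n : nat} {T : Type} {F : set_system T} {FF : Filter F}
    (f : T -> 'cV[Cx R]_n) (k : 'cV[Cx R]_n) :
  f @ F --> k -> enorm (f x) @[x --> F] --> enorm k.
Proof.
move=> /cvg_mxP fk.
apply: (@continuous_cvg _ R R); first exact: (@sqrt_continuous R).
by apply: cvg_sumr => i; apply: cvgM; apply: cvg_cabs; exact: fk.
Qed.

(** Such an [L] has trivial kernel.  The transpose appears because [kermx]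
    is a left kernel, acting on row vectors. *)
Lemma unitmx_bounded_below {n : nat} (c : R) (L : 'M[Cx R]_n) :
  0 < c -> (forall k, c * enorm k <= enorm (L *m k)) -> L \in unitmx.
Proof.
move=> c0 cL; rewrite -unitmx_tr -row_free_unit -kermx_eq0.
apply/eqP/row_matrixP => i; rewrite row0; set v := row i _.
have vL : L *m v^T = 0.
  by rewrite -[L]trmxK -trmx_mul -row_mul mulmx_ker row0 trmx0.
apply: trmx_inj; rewrite trmx0; apply: enorm_eq0; apply: le_anti.
rewrite enorm_ge0 andbT -(pmulr_rle0 _ c0); apply: le_trans (cL _) _.
by rewrite vL enorm0.
Qed.

End euclidean_norm.

(** * Nontangential limits of factors and products *)

Section boundary_values.
Context {R : realType} {W : set (Cx R)} {zeta : Cx R}.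

Lemma near_approach_region (P : set (Cx R)) (a : R) :
  (forall z, W z -> P z) ->
  \forall z \near within (approach_region W zeta a) (nbhs zeta), P z.
Proof.
move=> WP; have := withinT (approach_region W zeta a) (nbhs_filter zeta).
by apply: filterS => z [/WP].
Qed.

(** Here the accumulation clause of [nontangential_limit] is essential: a bound
    on [W] passes to the limit only along a proper filter. *)
Lemma nontangential_limit_enorm_le {n : nat} (phi : Cx R -> 'M[Cx R]_n)
    (L : 'M[Cx R]_n) (M : R) :
  nontangential_limit W phi zeta L ->
  (forall z, W z -> forall k, enorm (phi z *m k) <= M * enorm k) ->
  forall k, enorm (L *m k) <= M * enorm k.
Proof.
move=> [[a a0 cla] phiL] phiM k.
have FF := @within_nbhs_proper _ _ _ cla.
apply: (cvgr_to_le (cvg_enorm _ _ (cvg_mulmx _ _ _ _ (phiL a a0) (cvg_cst k)))).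
by apply: near_approach_region => z Wz; exact: phiM.
Qed.

Lemma nontangential_limit_factor {n : nat} (phi psi : Cx R -> 'M[Cx R]_n)
    (u : Cx R -> Cx R) (L : 'M[Cx R]_n) (l : Cx R) :
  L \in unitmx -> (forall z, W z -> phi z *m psi z = (u z)%:M) ->
  nontangential_limit W phi zeta L -> nontangential_limit W u zeta l ->
  nontangential_limit W psi zeta (invmx L *m l%:M).
Proof.
move=> uL phipsi [accL phiL] [_ ul]; split; first exact: accL.
move=> a a0; apply: cvg_mulmx_factor uL (phiL a a0) (ul a a0) _.
exact: near_approach_region.
Qed.

Lemma nontangential_limit_product {n : nat} (phi psi : Cx R -> 'M[Cx R]_n)
    (u : Cx R -> Cx R) (L P : 'M[Cx R]_n) (i0 : 'I_n) :
  (forall z, W z -> phi z *m psi z = (u z)%:M) ->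
  nontangential_limit W phi zeta L ->
  nontangential_limit W psi zeta P ->
  nontangential_limit W u zeta ((L *m P) i0 i0) /\
  L *m P = ((L *m P) i0 i0)%:M.
Proof.
move=> phipsi [accL phiL] [_ psiP]; split.
  split; first exact: accL.
  move=> a a0; apply: cvg_scalar_mulmx_diag (phiL a a0) (psiP a a0) _.
  exact: near_approach_region.
have [a a0 cla] := accL; have FF := @within_nbhs_proper _ _ _ cla.
apply: (cvg_scalar_mulmx_lim _ _ u _ _ _ (phiL a a0) (psiP a a0)).
exact: near_approach_region.
Qed.

End boundary_values.

(** * Quasi-inner functions *)

Section factorization.
Context {R : realType} {W : set (Cx R)} {m : probability (borelC R) R}.
Context {n : nat}.
Implicit Types (phi psi : Cx R -> 'M[Cx R]_n) (u : Cx R -> Cx R).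

(** The limit [P] satisfies [L *m P = l%:M]: an upper bound for the first factor
    and a lower bound for the scalar bound the second factor from below. *)
Lemma quasi_innerL_cofactor phi psi u :
  quasi_innerL W m phi -> quasi_inner W m u -> HinftyL W psi ->
  (forall z, W z -> phi z *m psi z = (u z)%:M) ->
  quasi_innerL W m psi.
Proof.
move=> [[_ [M phiM]] [c c0 phic]] [_ [d d0 ud]] Hpsi phipsi; split => //.
(* [M] need not be positive: it may be 0 if [phi] vanishes on [W]. *)
have M1_gt0 : 0 < Num.max M 1 by rewrite lt_max ltr01 orbT.
exists (d / Num.max M 1); first exact: divr_gt0.
apply: (@filterS2 _ _ (ae_filter_ringOfSetsType m) _ _ _ _ phic ud).
move=> zeta {}phic {}ud bz.
have [L phiL cL] := phic bz; have [l ul dl] := ud bz.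
have uL := unitmx_bounded_below c L c0 cL.
exists (invmx L *m l%:M).
  exact: nontangential_limit_factor phipsi phiL ul.
move=> k; rewrite mulrAC ler_pdivrMr// -mulmxA.
set k' := invmx L *m _.
have Lk' : enorm (L *m k') = cabs l * enorm k.
  by rewrite /k' mulKVmx// enorm_scalar.
have := nontangential_limit_enorm_le _ _ _ phiL phiM k'; rewrite Lk' => lek.
apply: le_trans (ler_wpM2r (enorm_ge0 k) dl) _.
apply: le_trans lek _; rewrite mulrC ler_wpM2l ?enorm_ge0//.
by rewrite le_max lexx.
Qed.

(** Lower bounds multiply, and testing [L *m P = l%:M] on one nonzero vector
    gives a lower bound for [l]; this vector exists because [0 < n]. *)
Lemma quasi_inner_product phi psi u : (0 < n)%N ->
  quasi_innerL W m phi -> quasi_innerL W m psi -> Hinfty W u ->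
  (forall z, W z -> phi z *m psi z = (u z)%:M) ->
  quasi_inner W m u.
Proof.
move=> n0 [_ [c c0 phic]] [_ [d d0 psid]] Hu phipsi; split => //.
exists (c * d); first exact: mulr_gt0.
apply: (@filterS2 _ _ (ae_filter_ringOfSetsType m) _ _ _ _ phic psid).
move=> zeta {}phic {}psid bz.
have [L phiL cL] := phic bz; have [P psiP dP] := psid bz.
have [ul LP] :=
  nontangential_limit_product _ _ _ _ _ (Ordinal n0) phipsi phiL psiP.
exists ((L *m P) (Ordinal n0) (Ordinal n0)) => //.
set l := (L *m P) _ _ in LP *.
pose k : 'cV[Cx R]_n := const_mx 1.
have k_gt0 : 0 < enorm k.
  rewrite lt_neqAle enorm_ge0 andbT eq_sym; apply/eqP => /enorm_eq0.
  by move=> /matrixP /(_ (Ordinal n0) 0) /eqP; rewrite !mxE oner_eq0.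
rewrite -(ler_pM2r k_gt0) -enorm_scalar -LP -mulmxA -mulrA.
by apply: le_trans (cL _); rewrite ler_pM2l.
Qed.

End factorization.

Theorem theorem3p5 (R : realType) (Omega : set (Cx R)) (n : nat) (z0 : Cx R)
    (m : probability (borelC R) R)
    (hOmega : bounded_fc_region Omega) (hn : (0 < n)%N) (hz0 : Omega z0)
    (hm : harmonic_measure Omega z0 m) :
  (forall (phi psi : Cx R -> 'M[Cx R]_n) (u : Cx R -> Cx R),
     quasi_innerL Omega m phi -> quasi_inner Omega m u -> HinftyL Omega psi ->
     (forall z, Omega z -> phi z *m psi z = (u z)%:M) ->
     quasi_innerL Omega m psi)
  /\
  (forall (phi psi : Cx R -> 'M[Cx R]_n) (u : Cx R -> Cx R),
     quasi_innerL Omega m phi -> quasi_innerL Omega m psi -> Hinfty Omega u ->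
     (exists2 z, Omega z & u z <> 0) ->
     (forall z, Omega z -> phi z *m psi z = (u z)%:M) \/
     (forall z, Omega z -> psi z *m phi z = (u z)%:M) ->
     quasi_inner Omega m u).
Proof.
split=> [phi psi u|phi psi u qphi qpsi Hu _ [phipsi|psiphi]].
- exact: quasi_innerL_cofactor.
- exact: quasi_inner_product qphi qpsi Hu phipsi.
- exact: quasi_inner_product qpsi qphi Hu psiphi.
Qed.
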